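(* $\mathrm{Ba}(C_p(\beta\omega))\neq\mathrm{Ba}(C_w(\beta\omega))$.
   Context: For a compact space $K$, $C_p(K)$ (resp. $C_w(K)$) denotes the Banach space $C(K)$ of continuous real-valued functions on $K$ equipped with the topology of pointwise convergence (resp. the weak topology), and $\mathrm{Ba}(\cdot)$ denotes the Baire $\sigma$-algebra of a topological space (the smallest $\sigma$-algebra making all continuous real-valued functions measurable). $\beta\omega$ is the Čech–Stone compactification of the discrete space $\omega$. *)

(* Defs.v *)
From HB Require Import structures.
From mathcomp Require Import all_boot all_order all_algebra.
From mathcomp Require Import all_classical all_reals all_analysis.
Set Implicit Arguments. Unset Strict Implicit. Unset Printing Implicit Defensive.
Import Order.TTheory GRing.Theory Num.Theory numFieldNormedType.Exports.
Local Open Scope classical_set_scope.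
Local Open Scope ring_scope.

Definition baire (R : realType) (T : topologicalType) (A : set T) : set (set T) :=
  <<s A, [set B : set T | exists (g : T -> R) (U : set R),
           [/\ {within A, continuous g}, open U & B = A `&` g @^-1` U] ] >>.

Definition CK (R : realType) (K : topologicalType) : set (K -> R) :=
  [set f | continuous f].

(** Continuous linear functionals on the Banach space C(K) (sup norm, i.e.
    the topology of uniform convergence), given as maps on K -> R whose values
    outside C(K) are irrelevant. *)
Definition cont_lin_functional (R : realType) (K : topologicalType)
    (l : (K -> R) -> R) : Prop :=
  (forall (a : R) (f g : K -> R), CK f -> CK g ->
      l (fun x => a * f x + g x) = a * l f + l g)
  /\ {within (@CK R K : set {uniform K -> R}),
        continuous (l : {uniform K -> R} -> R)}.

Definition dual (R : realType) (K : topologicalType) : Type :=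
  {l : (K -> R) -> R | cont_lin_functional l}.

(** Evaluation map into R^(dual of C(K)) with the product topology; the weak topology
    on C(K) is the subspace topology of the initial topology of this map. *)
Definition dual_eval (R : realType) (K : topologicalType) (f : K -> R) :
    {ptws dual R K -> R} := fun l => sval l f.

(** [K] together with [e] is (a copy of) the Cech-Stone compactification of the
    discrete space omega: a Hausdorff compactification of omega (e an embedding
    with dense image) in which omega is C*-embedded. *)
Definition is_beta_omega (R : realType) (K : topologicalType) (e : nat -> K) : Prop :=
  compact [set: K] /\ [/\ hausdorff_space K, injective e,
      (forall n, exists U : set K, open U /\ U `&` range e = [set e n]),
      closure (range e) = [set: K]
    & forall f : nat -> R, (exists M : R, forall n, `|f n| <= M) ->
        exists F : K -> R, continuous F /\ (forall n, F (e n) = f n)].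

Definition Cp_space (R : realType) (K : topologicalType) : topologicalType :=
  {ptws K -> R}.

(** The ambient space K -> R with the initial topology of the evaluations at
    continuous linear functionals of C(K); restricted to C(K) this is the weak
    topology of the Banach space C(K). *)
Definition Cw_space (R : realType) (K : topologicalType) : topologicalType :=
  initial_topology (@dual_eval R K).

(* Main.v *)
(** If the two sigma-algebras coincided, every continuous functional on C(K)
    would be measurable for [Ba(C_p(K))], so its restriction to the indicators
    of the clopen sets [cl A], A a subset of omega, would be built from
    countably many ultrafilters on omega. Identify the points of K with
    ultrafilters. Closing off a countable set of points shows that for every E
    in [Ba(C_p(K))] there are points p_0, p_1, ... such that, among the A in the
    ideal I = {A | A belongs to no non-principal p_n}, membership of A in E is
    decided, on a dense family of basic open sets of the Cantor space, by
    genericity (in the sense of Baire category) alone.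

    Let mu be a limit, at a point outside omega, of the uniform measures on the
    blocks [2^m, 2^(m+1)). The set {f | mu f > 1/4} is in [Ba(C_w(K))] but is not
    decided in this sense: I contains a set B with mu B >= 3/4 (remove from
    every block residue classes mod 2^(j+3) belonging to p_j), and both the
    empty set and B can be made generic, within I, by changing them only on
    a set of measure at most 1/4 (and on a finite set). *)
Require Import Defs.
From HB Require Import structures.
From mathcomp Require Import all_boot all_order all_algebra.
From mathcomp Require Import all_classical all_reals all_analysis.
From mathcomp Require Import zify lra.
Set Implicit Arguments. Unset Strict Implicit. Unset Printing Implicit Defensive.
Import Order.TTheory GRing.Theory Num.Theory numFieldNormedType.Exports.
Local Open Scope classical_set_scope.
Local Open Scope ring_scope.

(** * Continuous extensions, and points of [K] as ultrafilters on omega *)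

Definition bounded_seq (R : realType) (a : nat -> R) : Prop :=
  exists M : R, forall n, `|a n| <= M.

(* The continuous extension of [a]; a junk value if [a] is unbounded. *)
Definition ext (R : realType) (K : topologicalType) (e : nat -> K)
    (a : nat -> R) : K -> R :=
  xget (fun=> 0) [set F : K -> R | continuous F /\ forall n, F (e n) = a n].

Definition ind (R : realType) (A : nat -> bool) : nat -> R := fun n => (A n)%:R.

Definition chi (R : realType) (K : topologicalType) (e : nat -> K)
    (A : nat -> bool) : K -> R := ext e (ind R A).

Section BetaOmega.
Variables (R : realType) (K : topologicalType) (e : nat -> K).
Hypothesis He : is_beta_omega R e.
Implicit Types (A B : nat -> bool) (a b : nat -> R) (F G : K -> R).

Let hK : hausdorff_space K. Proof. by case: He => _ []. Qed.
Let e_inj : injective e. Proof. by case: He => _ []. Qed.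
Let e_dense : closure (range e) = setT. Proof. by case: He => _ []. Qed.

Lemma ext_spec a : bounded_seq a ->
  continuous (ext e a) /\ forall n, ext e a (e n) = a n.
Proof.
move=> ba; rewrite /ext.
by case: xgetP => [F _ //|]; case: He => _ [_ _ _ _ /(_ _ ba)[F FP]] /(_ F).
Qed.

Lemma ext_cont a : bounded_seq a -> continuous (ext e a).
Proof. by case/ext_spec. Qed.

Lemma extE a n : bounded_seq a -> ext e a (e n) = a n.
Proof. by case/ext_spec. Qed.

(** A finite part of omega is compact, hence closed, so a point outside omega is approached by every
    tail. *)
Lemma closure_tail (x : K) N : ~ range e x ->
  closure [set e n | n in [set n | (N <= n)%N]] x.
Proof.
move=> xe.
have : closure (range e) x by rewrite e_dense.
have -> : range e = [set e n | n in [set n | (n < N)%N]] `|`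
                    [set e n | n in [set n | (N <= n)%N]].
  rewrite -image_setU; congr (_ @` _); apply/seteqP; split => // n _ /=.
  by case: (ltnP n N); [left|right].
rewrite closureU => -[|//].
have fN : finite_set [set e n | n in [set n | (n < N)%N]].
  exact/finite_image/finite_II.
have /closure_id <- : closed [set e n | n in [set n | (n < N)%N]].
  by apply: compact_closed => //; exact: finite_compact.
by move=> [n _ en]; case: xe; exists n.
Qed.

Lemma closed_on_tail F (C : set R) N (x : K) : continuous F -> closed C ->
  (forall n, (N <= n)%N -> C (F (e n))) -> ~ range e x -> C (F x).
Proof.
move=> cF cC FC xe.
have cl : closed (F @^-1` C) by apply: closed_comp => // y _; exact: cF.
suff : closure [set e n | n in [set n | (N <= n)%N]] `<=` F @^-1` C.
  by move=> /(_ x (closure_tail N xe)).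
by rewrite [X in _ `<=` X](closure_id _).1//; apply: closure_subset => _ [n Nn <-]; exact: FC.
Qed.

Lemma closed_on_omega F (C : set R) (x : K) : continuous F -> closed C ->
  (forall n, C (F (e n))) -> C (F x).
Proof.
move=> cF cC FC; have [[n _ <-]//|xe] := pselect (range e x).
exact: (@closed_on_tail _ _ 0%N _ cF cC).
Qed.

Lemma le_on_tail F G N (x : K) : continuous F -> continuous G ->
  (forall n, (N <= n)%N -> F (e n) <= G (e n)) -> ~ range e x -> F x <= G x.
Proof.
move=> cF cG FG xe; rewrite -subr_ge0.
apply: (@closed_on_tail (fun y => G y - F y) [set r : R | 0 <= r] N) => //.
- by move=> y; apply: cvgB; [exact: cG|exact: cF].
- by move=> n Nn /=; rewrite subr_ge0 FG.
Qed.

Lemma le_on_omega F G (x : K) : continuous F -> continuous G ->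
  (forall n, F (e n) <= G (e n)) -> F x <= G x.
Proof.
move=> cF cG FG; have [[n _ <-]//|xe] := pselect (range e x).
exact: (@le_on_tail _ _ 0%N).
Qed.

Lemma eq_on_omega F G (x : K) : continuous F -> continuous G ->
  (forall n, F (e n) = G (e n)) -> F x = G x.
Proof.
by move=> cF cG FG; apply/eqP; rewrite eq_le !le_on_omega// => n; rewrite FG.
Qed.

Lemma bounded_ind A : bounded_seq (ind R A).
Proof. by exists 1 => n; rewrite /ind; case: (A n); rewrite ?normr1 ?normr0. Qed.
Hint Resolve bounded_ind : core.

Lemma chi_cont A : continuous (chi R e A : K -> R).
Proof. exact: ext_cont. Qed.
Hint Resolve chi_cont : core.

Lemma chiE A n : chi R e A (e n) = (A n)%:R :> R.
Proof. exact: extE. Qed.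

(* [A] belongs to the ultrafilter [x]. *)
Definition ev (x : K) A : bool := chi R e A x == 1 :> R.

(** The values on omega lie in the closed set {0, 1}, so by density all values do. *)
Lemma chi_ev A x : chi R e A x = (ev x A)%:R.
Proof.
have : ([set 0; 1] : set R) (chi R e A x).
  apply: closed_on_omega => //.
    by apply: closedU; exact: (accessible_closed_set1 (hausdorff_accessible (@norm_hausdorff _ R))).
  by move=> n; rewrite chiE; case: (A n); [right|left].
by rewrite /ev => -[] /= ->; rewrite ?eqxx// eq_sym oner_eq0.
Qed.

Lemma ev_e A n : ev (e n) A = A n.
Proof. by rewrite /ev chiE; case: (A n); rewrite ?eqxx// eq_sym oner_eq0. Qed.

(** Non-principal ultrafilters do not see finite changes of a set. *)
Lemma ev_sub_tail N A B x : (forall n, (N <= n)%N -> A n -> B n) -> ~ range e x ->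
  ev x A -> ev x B.
Proof.
move=> AB xe Ax.
have : chi R e A x <= chi R e B x :> R.
  apply: (@le_on_tail _ _ N) => // n Nn; rewrite !chiE ler_nat.
  by have := AB n Nn; case: (A n) => // /(_ isT) ->.
by rewrite !chi_ev Ax; case: (ev x B); rewrite // ler10.
Qed.

Lemma ev_sub A B x : (forall n, A n -> B n) -> ev x A -> ev x B.
Proof.
move=> AB; have [[n _ <-]|xe] := pselect (range e x); first by rewrite !ev_e; exact: AB.
by apply: (@ev_sub_tail 0%N) => // n _; exact: AB.
Qed.

Lemma ev_neg A x : ev x (fun n => ~~ A n) = ~~ ev x A.
Proof.
have : chi R e (fun n => ~~ A n) x = 1 - chi R e A x :> R.
  apply: (@eq_on_omega _ (fun x => 1 - chi R e A x)) => //.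
    by move=> y; apply: cvgB; [exact: cvg_cst|exact: chi_cont].
  by move=> n; rewrite !chiE; case: (A n); rewrite ?subrr ?subr0.
rewrite !chi_ev; case: (ev x A); case: (ev x _) => //=; rewrite ?subrr ?subr0.
  by move/eqP; rewrite oner_eq0.
by move/esym/eqP; rewrite oner_eq0.
Qed.

Lemma ev_and A B x : ev x (fun n => A n && B n) = ev x A && ev x B.
Proof.
apply/idP/andP => [|[Ax Bx]].
  by move=> AB; split; apply: ev_sub AB => n /andP[].
have : chi R e A x + chi R e B x <= 1 + chi R e (fun n => A n && B n) x :> R.
  apply: (@le_on_omega (fun x => chi R e A x + chi R e B x)
    (fun x => 1 + chi R e (fun n => A n && B n) x)) => //.
  - by move=> y; apply: cvgD; exact: chi_cont.
  - by move=> y; apply: cvgD; [exact: cvg_cst|exact: chi_cont].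
  - move=> n; rewrite !chiE; case: (A n) (B n) => -[] //=; lra.
by rewrite !chi_ev Ax Bx; case: (ev x _) => //=; lra.
Qed.

Lemma ev_or A B x : ev x (fun n => A n || B n) = ev x A || ev x B.
Proof.
rewrite -[RHS]negbK negb_or -!ev_neg -ev_and -ev_neg; congr (ev x _).
by apply/funext => n; rewrite negb_and !negbK.
Qed.

Lemma ev_false x : ev x (fun=> false) = false.
Proof.
apply/negbTE; rewrite -ev_neg /=.
rewrite /ev (@eq_on_omega _ (fun=> 1)) ?eqxx //; first by move=> y; exact: cvg_cst.
by move=> n; rewrite chiE.
Qed.

(** The separating set is the trace on omega of a neighbourhood of [x] that is disjoint from a
    neighbourhood of [y]. *)
Lemma ev_sep (x y : K) : x != y -> exists A, ev x A /\ ~~ ev y A.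
Proof.
move=> xy; have := hK; rewrite open_hausdorff.
move=> /(_ x y xy) [[U V] /= [/set_mem Ux /set_mem Vy] [oU oV /eqP UV0]].
pose A n : bool := `[< U (e n) >]; exists A.
(* By density of omega, [z] lies in the closure of the trace of its neighbourhood [W], where [chi B]
   equals 1. *)
have key (W : set K) z B : open W -> W z -> (forall n, W (e n) -> B n) -> ev z B.
  move=> oW Wz WB; rewrite /ev.
  have : closure (range e) z by rewrite e_dense.
  have cl : closed ((chi R e B : K -> R) @^-1` [set 1]).
    apply: closed_comp; first by move=> ? _; exact: chi_cont.
    exact: (accessible_closed_set1 (hausdorff_accessible (@norm_hausdorff _ R))).
  move=> ez; apply/eqP.
  suff : closure (W `&` range e) `<=` (chi R e B : K -> R) @^-1` [set 1].
    apply=> N Nz; have WNz : nbhs z (N `&` W).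
      by apply: filterI => //; exact: open_nbhs_nbhs.
    by have [w [rw [Nw Ww]]] := ez _ WNz; exists w.
  rewrite ((closure_id _).1 cl); apply: closure_subset => w [We [n _ enE]].
  by rewrite -enE /= chiE WB// enE.
split; first by apply: (key U) => // n Un; apply/asboolP.
rewrite -ev_neg; apply: (key V) => //.
move=> n Vn; apply/negP => /asboolP Un.
by have : (U `&` V) (e n) by []; rewrite UV0.
Qed.

End BetaOmega.

(** Stage n+1 keeps the points of stage n and adds all points occurring in values of [Phi] on finite
    lists over stage n. The union of the stages is countable, and it is closed because a finite list
    over it already lives in one stage. *)
Lemma closing_off (T : Type) (e : nat -> T)
    (Phi : nat -> seq (T * bool) -> seq (T * bool)) :
  exists p : nat -> T, (forall n, exists m, p m = e n) /\
    forall k (r : seq (nat * bool)) i, (i < size (Phi k [seq (p z.1, z.2) | z <- r]))%N ->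
      exists m, p m = (nth (p 0%N, false) (Phi k [seq (p z.1, z.2) | z <- r]) i).1.
Proof.
pose step (q : nat -> T) (m : nat) : T :=
  match @unpickle (nat + (nat * seq (nat * bool) * nat))%type m with
  | Some (inl n) => q n
  | Some (inr (k, r, i)) => (nth (q 0%N, false) (Phi k [seq (q z.1, z.2) | z <- r]) i).1
  | None => q 0%N
  end.
pose Q n := iter n step e.
have QS n m : exists m', Q n.+1 m' = Q n m.
  by exists (pickle (inl m : nat + (nat * seq (nat * bool) * nat))); rewrite /Q /= /step pickleK.
have Qle n n' m : (n <= n')%N -> exists m', Q n' m' = Q n m.
  elim: n' => [|n' IH]; first by rewrite leqn0 => /eqP ->; exists m.
  rewrite leq_eqVlt => /orP[/eqP ->|]; first by exists m.
  by rewrite ltnS => /IH[m' <-]; exact: QS.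
pose p m := if @unpickle (nat * nat)%type m is Some (n, i) then Q n i else e 0%N.
have pQ n i : exists m, p m = Q n i.
  by exists (pickle (n, i)); rewrite /p pickleK.
exists p; split; first by move=> n; exact: (pQ 0%N n).
move=> k r i ir.
have Qp m : exists n i, p m = Q n i.
  by rewrite /p; case: unpickle => [[n j]|]; [exists n, j|exists 0%N, 0%N].
have [N [r' rr']] : exists N r', [seq (p z.1, z.2) | z <- r] = [seq (Q N z.1, z.2) | z <- r'].
  elim: r {ir} => [|z r [N [r' /= ->]]]; first by exists 0%N, [::].
  have [n [j ->]] := Qp z.1.
  have [j' Ej] := Qle n (maxn n N) j (leq_maxl _ _).
  have lift m : exists m', Q (maxn n N) m' = Q N m by apply: Qle; exact: leq_maxr.
  have [f fE] := choice lift.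
  exists (maxn n N), ((j', z.2) :: [seq (f y.1, y.2) | y <- r']) => /=.
  by rewrite Ej -map_comp; congr cons; apply: eq_map => y /=; rewrite fE.
have [m pm] := pQ N.+1 (pickle (inr (k, r', i) : nat + (nat * seq (nat * bool) * nat))).
exists m; rewrite pm /Q iterS /step pickleK -/(Q N) rr'; congr (_.1).
by apply: set_nth_default; rewrite -rr'.
Qed.

(** * Finite conditions on subsets of omega *)

Section Conditions.
Variables (R : realType) (K : topologicalType) (e : nat -> K).
Hypothesis He : is_beta_omega R e.
Implicit Types (A B : nat -> bool) (c r : seq (K * bool)).

Local Notation ev := (@ev R K e).

(* Conditions are finite partial maps from K to {0, 1}, i.e. names of basic
   open sets of [C_p(K, {0, 1})]. *)
Definition sat A c := forall q, q \in c -> ev q.1 A = q.2.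

Definition consistent c := forall x, (x, true) \in c -> (x, false) \in c -> False.

Lemma sat_cat A c r : sat A (c ++ r) <-> sat A c /\ sat A r.
Proof.
split=> [s|[sc sr] q].
  by split=> q qc; apply: s; rewrite mem_cat qc ?orbT.
by rewrite mem_cat => /orP[/sc|/sr].
Qed.

Lemma ev_sep_seq (x : K) (l : seq K) : x \notin l ->
  exists A, ev x A /\ forall y, y \in l -> ~~ ev y A.
Proof.
elim: l => [_|y l IH].
  by exists (fun=> true); split => //; have := ev_neg He (fun=> false) x; rewrite ev_false.
rewrite inE negb_or => /andP[xy /IH[A [xA lA]]].
have [B [xB yB]] := ev_sep He xy.
exists (fun n => A n && B n); rewrite ev_and// xA xB; split => // z.
rewrite inE ev_and// => /orP[/eqP ->|/lA]; first by rewrite negb_and yB orbT.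
by move=> zA; rewrite negb_and zA.
Qed.

(** Distinct ultrafilters can be prescribed independently: the value at a new point [x] is corrected
    by adding or removing a set [Z] that belongs to [x] and to no point treated before. *)
Lemma consistent_sat c : consistent c -> exists A, sat A c.
Proof.
elim: c => [|[x b] c IH] cc; first by exists (fun=> false).
have [|A sA] := IH.
  by move=> y yt yf; apply: (cc y); rewrite inE ?yt ?yf orbT.
have [xc|xc] := boolP (x \in [seq q.1 | q <- c]).
  exists A => q; rewrite inE => /orP[/eqP ->|]; last exact: sA.
  move/mapP: xc => [[y b'] yc /= xy]; rewrite -xy in yc.
  rewrite (sA _ yc)/=; case: b b' {sA xy} cc yc => -[] // cc yc; exfalso.
    by apply: (cc x); rewrite inE ?yc ?eqxx ?orbT.
  by apply: (cc x); rewrite inE ?yc ?eqxx ?orbT.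
have [Z [xZ lZ]] := ev_sep_seq xc.
exists (fun n => if b then A n || Z n else A n && ~~ Z n) => q.
rewrite inE => /orP[/eqP ->|qc] /=.
  by case: (b); rewrite ?ev_or// ?ev_and// ?ev_neg// xZ ?orbT ?andbF.
have /lZ qZ : q.1 \in [seq q.1 | q <- c] by apply/mapP; exists q.
by case: (b); rewrite ?ev_or// ?ev_and// ?ev_neg// (negbTE qZ) sA// ?orbF ?andbT.
Qed.

Lemma sat_consistent A c : sat A c -> consistent c.
Proof. by move=> sA x /sA /= + /sA /= => ->. Qed.

Lemma cond_nbhs (g : (K -> R) -> R) A :
  {within (@CK R K : set (Cp_space R K)), continuous (g : Cp_space R K -> R)} ->
  forall eps : R, 0 < eps -> exists c, sat A c /\
    forall B, sat B c -> `|g (chi R e A) - g (chi R e B)| < eps.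
Proof.
move=> /subspace_continuousP cg eps eps0.
(* The filter generated by the conditions that [A] satisfies converges pointwise to [chi A], since
   one condition fixes the value of an indicator at a point. *)
pose F : set_system (Cp_space R K) :=
  filter_from (sat A) (fun c => [set (chi R e B : Cp_space R K) | B in [set B | sat B c]]).
have FF : Filter F.
  apply: filter_from_filter; first by exists [::].
  move=> c r sc sr; exists (c ++ r); first exact/sat_cat.
  by move=> _ [B /sat_cat[Bc Br] <-]; split; exists B.
have Fchi : {ptws, F --> (chi R e A : K -> R)}.
  apply/pointwise_cvgP => x W Wx.
  exists [:: (x, ev x A)]; first by move=> q; rewrite inE => /eqP ->.
  move=> _ [B sB <-] /=; rewrite chi_ev// (sB (x, ev x A)) ?inE//= -chi_ev//.
  exact: nbhs_singleton.
have FCK : F (@CK R K : set (Cp_space R K)).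
  by exists [::] => // _ [B _ <-]; exact: chi_cont.
have /cvgrPdist_lt/(_ _ eps0) : (g : Cp_space R K -> R) x @[x --> F] --> g (chi R e A).
  move=> W /cg-/(_ (@chi_cont _ _ _ He A)) /Fchi FW.
  by apply: (@filterS2 _ F FF _ _ (g @^-1` W) _ FCK FW) => f cf; exact.
move=> [c sc cF]; exists c; split => // B sB.
by apply: (cF (chi R e B)); exists B.
Qed.

End Conditions.

(** * Basic open sets of the Cantor space *)

Definition extends (A : nat -> bool) (t : seq bool) := mkseq A (size t) = t.

Lemma extendsP A t :
  extends A t <-> forall i, (i < size t)%N -> A i = nth false t i.
Proof.
split=> [<- i|At]; first by rewrite size_mkseq => it; rewrite nth_mkseq.
apply: (@eq_from_nth _ false); rewrite size_mkseq// => i it.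
by rewrite nth_mkseq// At.
Qed.

Lemma extends_prefix A s t : prefix s t -> extends A t -> extends A s.
Proof.
move=> /prefixP[w ->] /extendsP At; apply/extendsP => i si.
by rewrite At ?nth_cat ?si// size_cat ltn_addr.
Qed.

Lemma extends_mkseq A k : extends A (mkseq A k).
Proof. by rewrite /extends size_mkseq. Qed.

Lemma prefix_mkseq A s k : extends A s -> (size s <= k)%N -> prefix s (mkseq A k).
Proof.
move=> sA sk; apply/prefixP; exists [seq A i | i <- iota (size s) (k - size s)].
by rewrite -[X in X ++ _]sA /mkseq -map_cat -{2}[size s]add0n -iotaD subnKC.
Qed.

(** [D] stands for the union of the basic open sets that its members name; this open set is dense,
    and [hits] is membership in it. *)
Definition dense_seq (D : set (seq bool)) := forall u, exists2 v, D v & prefix u v.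

Definition hits (A : nat -> bool) (D : set (seq bool)) := exists k, D (mkseq A k).

(** * The sigma-algebra of decided sets *)

Section Decided.
Variables (R : realType) (K : topologicalType) (e : nat -> K).
Hypothesis He : is_beta_omega R e.
Let e_inj : injective e. Proof. by case: He => _ []. Qed.
Implicit Types (A B : nat -> bool) (c r : seq (K * bool)) (p : nat -> K)
  (E : set (K -> R)) (s t u : seq bool).

Local Notation ev := (@ev R K e).
Local Notation sat := (@sat R K e).
Local Notation chi := (@chi R K e).

Definition vanish p A := forall n, ~ range e (p n) -> ev (p n) A = false.

(* Finite sequences [t] name basic open sets of the Cantor space: comeagerly
   many [A] in such a set, among those that vanish on [p], satisfy [E]. *)
Definition generic p t E := exists W : nat -> set (seq bool),
  (forall m, dense_seq (W m)) /\
  forall A, extends A t -> vanish p A -> (forall m, hits A (W m)) -> E (chi A).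

(** A form of the Baire property for the trace of [E] on an ideal; the points [p], hence the ideal,
    may depend on [E]. *)
Definition decided E := exists p, forall s, exists2 t, prefix s t &
  generic p t E \/ generic p t (~` E).

Lemma generic_sub p t E E' : E `<=` E' -> generic p t E -> generic p t E'.
Proof. by move=> EE' [W [dW WE]]; exists W; split => // A tA pA /WE; auto. Qed.

Lemma decided0 : decided set0.
Proof.
exists (fun=> e 0%N) => s; exists s; first exact: prefix_refl.
by right; exists (fun=> setT); split => [m u|A _ _ _ []]; exists u => //; exact: prefix_refl.
Qed.

Lemma decidedC E : decided E -> decided (@CK R K `\` E).
Proof.
move=> [p pE]; exists p => s; have [t st Et] := pE s; exists t; first by [].
case: Et => Et; [right|left].
  by apply: generic_sub Et => f Ef [].
have [W [dW WE]] := Et; exists W; split => // A tA pA WA.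
by split; [exact: chi_cont|exact: WE].
Qed.

(** Either some [E i] is generic somewhere below [s], which suffices, or every complement is generic
    on a dense family below [s], and the countably many dense sets involved can be combined. *)
Lemma decided_bigcup (E : nat -> set (K -> R)) :
  (forall i, decided (E i)) -> decided (\bigcup_i E i).
Proof.
move=> dE; have [p pE] := choice dE.
pose q m := if @unpickle (nat * nat)%type m is Some (i, n) then p i n else e 0%N.
have vq A i : vanish q A -> vanish (p i) A.
  move=> qA n; have := qA (pickle (i, n)); rewrite /q pickleK; exact.
exists q => s.
have [[i [t [st [W [dW WE]]]]]|noE] :=
    pselect (exists i t, prefix s t /\ generic (p i) t (E i)).
  exists t; first by []; left; exists W; split => // A tA /vq qA WA.
  by exists i => //; exact: WE.
exists s; first exact: prefix_refl.
right.
have someC i t : prefix s t -> exists2 t', prefix t t' & generic (p i) t' (~` E i).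
  move=> st; have [t' tt' [Et'|]] := pE i t; last by exists t'.
  by case: noE; exists i, t'; split => //; exact: prefix_trans tt'.
have chooseW (it : nat * seq bool) : exists W : nat -> set (seq bool),
    (forall m, dense_seq (W m)) /\ (generic (p it.1) it.2 (~` E it.1) ->
     forall A, extends A it.2 -> vanish (p it.1) A -> (forall m, hits A (W m)) ->
     ~ E it.1 (chi A)).
  have [[W [dW WE]]|nl] := pselect (generic (p it.1) it.2 (~` E it.1)).
    by exists W; split.
  exists (fun=> setT); split => // m u; exists u => //; exact: prefix_refl.
have [W WP] := choice chooseW.
(* Density is required everywhere, so nothing is asked of [u] off [s]; the bound on the length keeps
   a [u] shorter than [s] from entering vacuously. *)
pose D i := [set u | prefix s u -> exists2 t, prefix t u & generic (p i) t (~` E i)]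
  `&` [set u | (size s <= size u)%N].
have dD i : dense_seq (D i).
  move=> u; pose u' := u ++ nseq (size s) false.
  have uu' : prefix u u' by exact: prefix_prefix.
  have su' : (size s <= size u')%N by rewrite size_cat size_nseq leq_addl.
  have [ss|ss] := boolP (prefix s u').
    have [t' ut' lt'] := someC i _ ss; exists t'; last exact: prefix_trans ut'.
    by split => [_|] /=; [exists t' => //; exact: prefix_refl|exact: leq_trans (size_prefix ut')].
  by exists u' => //; split => //= sp; rewrite sp in ss.
exists (fun m => match @unpickle (nat + (nat * seq bool * nat))%type m with
  | Some (inl i) => D i | Some (inr (it, m)) => W it m | None => setT end).
split=> [m|A sA qA WA [i _ EiA]].
  case: unpickle => [[i|[it m']]|]; [exact: dD|exact: (WP it).1|].
  by move=> u; exists u => //; exact: prefix_refl.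
have := WA (pickle (inl i : nat + (nat * seq bool * nat))); rewrite pickleK.
move=> [k [/= sk]]; rewrite size_mkseq => lek.
have [t tk lt] := sk (prefix_mkseq sA lek).
apply: ((WP (i, t)).2 lt A _ _ _ EiA) => /=.
- exact: extends_prefix tk (extends_mkseq A k).
- exact: vq.
- by move=> m; have := WA (pickle (inr (i, t, m) : nat + (nat * seq bool * nat))); rewrite pickleK.
Qed.

Lemma sigma_algebra_decided : sigma_algebra (@CK R K) decided.
Proof. split; [exact: decided0|exact: decidedC|exact: decided_bigcup]. Qed.

Definition cond_of t : seq (K * bool) := [seq (e i, nth false t i) | i <- iota 0 (size t)].

Lemma cond_of_sat A t : sat A (cond_of t) <-> extends A t.
Proof.
split=> [sA|/extendsP At q /mapP[i]].
  apply/extendsP => i it; have /= := sA (e i, nth false t i).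
  by rewrite ev_e// => -> //; apply/mapP; exists i => //; rewrite mem_iota.
by rewrite mem_iota => /= it ->; rewrite ev_e//= At.
Qed.

Lemma mem_cond_of t i : (i < size t)%N -> (e i, nth false t i) \in cond_of t.
Proof. by move=> it; apply/mapP; exists i => //; rewrite mem_iota. Qed.

Lemma decided_gen (g : Cp_space R K -> R) (U : set R) :
  {within (@CK R K : set (Cp_space R K)), continuous g} -> open U ->
  decided (@CK R K `&` g @^-1` U).
Proof.
move=> cg oU.
pose C (k : nat) c := forall B, sat B c ->
  forall y : R, `|g (chi B) - y| < k.+1%:R^-1 -> U y.
have Ccofinal A : U (g (chi A)) -> exists k c, C k c /\ sat A c.
  move=> UA; have /nbhs_ballP[eps /= eps0 epsU] : nbhs (g (chi A)) U by exact: open_nbhs_nbhs.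
  have /ltr_add_invr[k] : 0 < eps / 2 by rewrite divr_gt0.
  rewrite add0r => keps.
  have k0 : (0 : R) < k.+1%:R^-1 by rewrite invr_gt0.
  have [c [cA cg']] := cond_nbhs He A cg k0.
  exists k, c; split => // B sB y By; apply: epsU; rewrite /ball /=.
  apply: le_lt_trans (ler_distD (g (chi B)) (g (chi A)) y) _.
  by rewrite [eps]splitr; apply: ltrD; apply: lt_trans keps => //; exact: cg'.
(* [Ck k r] collects the conditions inside [{g in U}], at distance 1/(k+1) from
   its boundary, that refine [r]. With [range p] closed under a choice of
   such conditions, whether [r] over [range p] can be refined into
   [{g in U}] is already visible in [range p]. *)
pose Ck k r c := [/\ C k c, consistent c & {subset r <= c}].
pose Phi k r := xget [::] (Ck k r).
have [p [pe pPhi]] := closing_off e Phi.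
have key k (r : seq (nat * bool)) :
    (exists c, Ck k [seq (p z.1, z.2) | z <- r] c) ->
    exists2 c, Ck k [seq (p z.1, z.2) | z <- r] c & forall q, q \in c -> range p q.1.
  move=> [c cP]; exists (Phi k [seq (p z.1, z.2) | z <- r]); first exact: (xgetI [::] cP).
  move=> q qP; have := pPhi k r (index q (Phi k [seq (p z.1, z.2) | z <- r])).
  by rewrite index_mem qP nth_index// => /(_ isT)[m <-]; exists m.
pose valid (F : seq nat) := forall m, m \in F -> ~ range e (p m).
pose zero (F : seq nat) : seq (K * bool) := [seq (p m, false) | m <- F].
have zero_sat A F : valid F -> vanish p A -> sat A (zero F).
  by move=> vF pA q /mapP[m mF ->] /=; apply: pA; exact: vF.
have coded t (F : seq nat) : exists r : seq (nat * bool),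
      [seq (p z.1, z.2) | z <- r] = cond_of t ++ zero F.
  have [f fE] := choice pe.
  exists ([seq (f i, nth false t i) | i <- iota 0 (size t)] ++ [seq (m, false) | m <- F]).
  rewrite map_cat -!map_comp; congr cat; apply: eq_map => i //=.
  by rewrite fE.
exists p => s.
(* In the first case all [A] vanishing on [p] below [t] lie in the closure of
   the k-th set, hence in [{g in U}]; otherwise conditions avoiding every
   k-th set are dense. *)
have [[t [st [k tk]]]|ntk] := pselect (exists t, prefix s t /\ exists k,
    forall t', prefix t t' -> forall F, valid F ->
    exists c, Ck k (cond_of t' ++ zero F) c).
  exists t; first by []; left; exists (fun=> setT); split.
    by move=> m u; exists u => //; exact: prefix_refl.
  move=> A tA pA _; split; first exact: chi_cont.
  have k0 : (0 : R) < k.+1%:R^-1 by rewrite invr_gt0.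
  have [c0 [c0A c0g]] := cond_nbhs He A cg k0.
  (* [L] exceeds all principal points in [c0], and [F] covers its non-principal points in [range p].
     As [c] will live on [range p], these are all the points that [c] and [c0] can share. *)
  have [L [F [tL vF LF]]] : exists (L : nat) (F : seq nat), [/\ (size t <= L)%N, valid F &
      forall q, q \in c0 -> (forall n, q.1 = e n -> (n < L)%N) /\
      (forall m, q.1 = p m -> ~ range e q.1 -> exists2 m', m' \in F & p m' = q.1)].
    elim: c0 {c0A c0g} => [|q c0 [L [F [tL vF LF]]]]; first by exists (size t), [::].
    have [[n _ qn]|qe] := pselect (range e q.1).
      exists (maxn L n.+1), F; split; rewrite ?leq_max ?tL// => q'.
      rewrite inE => /orP[/eqP ->|/LF[q'L q'F]]; split => //.
      - by move=> n'; rewrite -qn => /e_inj <-; rewrite leq_max ltnSn orbT.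
      - by move=> m _ []; exists n.
      - by move=> n' /q'L n'L; rewrite leq_max n'L.
    have [[m _ qm]|qp] := pselect (range p q.1).
      exists L, (m :: F); split=> // [m'|q'].
        by rewrite inE => /orP[/eqP ->|/vF//]; rewrite qm.
      rewrite inE => /orP[/eqP ->|/LF[q'L q'F]]; split => //.
      - by move=> n qn; case: qe; exists n.
      - by move=> m' _ _; exists m; rewrite ?inE ?eqxx.
      - by move=> m' qm' qe'; have [m2 m2F <-] := q'F m' qm' qe'; exists m2;
           rewrite ?inE ?m2F ?orbT.
    exists L, F; split => // q'; rewrite inE => /orP[/eqP ->|/LF//]; split.
      by move=> n qn; case: qe; exists n.
    by move=> m qm; case: qp; exists m.
  have [r rE] := coded (mkseq A L) F.
  have := tk _ (prefix_mkseq tA tL) _ vF.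
  rewrite -rE => /key[c [Cc cc rc] cJ]; rewrite rE in rc.
  have [B /sat_cat[Bc0 Bc]] : exists B, sat B (c0 ++ c).
    apply: consistent_sat => //.
    (* At a shared point both values are those of [A]: principal points are fixed by [cond_of], the
       others are sent to false by [zero F], and [A] vanishes there. *)
    have agree x b b' : (x, b) \in c0 -> (x, b') \in c -> b = b'.
      move=> xc0 xc; have /= <- := c0A _ xc0; have /= [xL xF] := LF _ xc0.
      have det b2 : (x, b2) \in c -> b' = b2.
        by case: b' b2 xc => -[] // h1 h2; case: (cc x).
      have [[n _ xn]|xe] := pselect (range e x).
        have nL : (n < L)%N by apply: xL.
        apply/esym/det; rewrite -xn ev_e//; apply: rc.
        rewrite mem_cat; apply/orP; left.
        have := @mem_cond_of (mkseq A L) n; rewrite size_mkseq nth_mkseq//.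
        by apply.
      have [m _ xm] := cJ _ xc.
      have [m' m'F pm'] := xF m (esym xm) xe.
      have -> : ev x A = false by rewrite -pm'; apply: pA; rewrite pm'.
      apply/esym/det/rc; rewrite mem_cat; apply/orP; right.
      by apply/mapP; exists m' => //; rewrite pm'.
    move=> x; rewrite !mem_cat => /orP[xt|xt] /orP[xf|xf].
    - exact: (sat_consistent c0A xt xf).
    - by have := agree _ _ _ xt xf.
    - by have := agree _ _ _ xf xt.
    - exact: (cc x).
  (* [g (chi B)] has a margin of 1/(k+1) inside [U], and [g (chi A)] lies within this margin. *)
  apply: (Cc B) => //; rewrite distrC; exact: c0g.
exists s; first exact: prefix_refl.
right.
have bad t k : prefix s t -> exists t', prefix t t' /\
    exists F, valid F /\ forall c, ~ Ck k (cond_of t' ++ zero F) c.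
  move=> st; apply: contrapT => nt; case: ntk; exists t; split => //; exists k.
  move=> t' tt' F vF; apply: contrapT => nc; case: nt; exists t'; split => //.
  by exists F; split => // c cP; case: nc; exists c.
pose D k := [set u | prefix s u -> exists t', prefix t' u /\
    exists F, valid F /\ forall c, ~ Ck k (cond_of t' ++ zero F) c]
  `&` [set u | (size s <= size u)%N].
exists D; split => [k u|A sA pA DA [_ UA]].
  pose u' := u ++ nseq (size s) false.
  have uu' : prefix u u' by exact: prefix_prefix.
  have su' : (size s <= size u')%N by rewrite size_cat size_nseq leq_addl.
  have [ss|ss] := boolP (prefix s u').
    have [t' [ut' nF]] := bad _ k ss; exists t'; last exact: prefix_trans ut'.
    split => [_|] /=; last exact: leq_trans (size_prefix ut').
    by exists t'; split => //; exact: prefix_refl.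
  by exists u' => //; split => //= sp; rewrite sp in ss.
have [k [c [Cc sc]]] := Ccofinal A UA.
have [l [/= Dl]] := DA k; rewrite size_mkseq => sl.
have [t' [tl [F [vF nc]]]] := Dl (prefix_mkseq sA sl).
(* [A] satisfies all three pieces, so together they form a consistent refinement of the kind that
   [D k] excludes. *)
apply: (nc (c ++ cond_of t' ++ zero F)); split.
- by move=> B /sat_cat[sB _]; exact: Cc.
- apply: (@sat_consistent R K e A); apply/sat_cat; split=> //; apply/sat_cat; split.
    apply/cond_of_sat; exact: extends_prefix tl (extends_mkseq A l).
  exact: zero_sat.
- by move=> q qr; rewrite mem_cat qr orbT.
Qed.

Lemma baire_decided E : @baire R (Cp_space R K) (@CK R K) E -> decided E.
Proof.
apply: (smallest_sub sigma_algebra_decided) => _ [g [U [cg oU ->]]].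
exact: decided_gen.
Qed.

End Decided.

(** * Fusion of dense open sets, and elementary counting *)

Lemma dense_absorb (W : nat -> set (seq bool)) (l : seq (seq bool * nat)) :
  (forall m, dense_seq (W m)) ->
  exists w, forall q, q \in l -> exists2 v, W q.2 v & prefix v (q.1 ++ w).
Proof.
move=> dW; elim: l => [|q l [w wl]]; first by exists [::].
(* Lengthening [w] for the new task preserves the earlier ones, which only ask for a prefix. *)
have [v0 Wv /prefixP[w' v0E]] := dW q.2 (q.1 ++ w); subst v0.
exists (w ++ w') => q'; rewrite inE => /orP[/eqP ->|/wl[v Wv' vw]].
  by exists ((q.1 ++ w) ++ w') => //; rewrite catA prefix_refl.
by exists v => //; rewrite catA; apply: prefix_trans vw _; exact: prefix_prefix.
Qed.

(* A set that agrees with [x] on infinitely many blocks meets every [W m]. *)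
Lemma fusion (W : nat -> set (seq bool)) (t : seq bool) :
  (forall m, dense_seq (W m)) ->
  exists (k : nat -> nat) (x : nat -> bool),
    [/\ k 0%N = size t, forall n, (k n < k n.+1)%N &
      forall A n, (forall i, (k n <= i < k n.+1)%N -> A i = x i) ->
        forall m, (m <= n)%N -> hits A (W m)].
Proof.
move=> dW.
have stepP (kn : nat * nat) : exists w, (0 < size w)%N /\ forall u, size u = kn.1 ->
    forall m, (m <= kn.2)%N -> exists2 v, W m v & prefix v (u ++ w).
  (* All words of the given length are listed, so that one block [w] works whatever precedes it. *)
  have [w wP] := dense_absorb
    [seq (val u, m) | u <- enum {: kn.1.-tuple bool}, m <- iota 0 kn.2.+1] dW.
  (* The extra letter makes the block non-empty, so that [k] increases strictly. *)
  exists (rcons w false); split=> [|u uk m mn]; first by rewrite size_rcons.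
  have [|v Wv vw] := wP (u, m).
    apply/allpairsP; exists (tcast uk (in_tuple u), m); split.
    - by rewrite mem_enum.
    - by rewrite mem_iota ltnS.
    - by rewrite /= val_tcast.
  exists v => //; rewrite -cats1 catA; apply: prefix_trans vw _; exact: prefix_prefix.
have [step {}stepP] := choice stepP.
have [X [X0 XS]] : exists X : nat -> seq bool,
    X 0%N = t /\ forall n, X n.+1 = X n ++ step (size (X n), n).
  by exists (fix X n := if n is n'.+1 then X n' ++ step (size (X n'), n') else t).
have ltX n : (size (X n) < size (X n.+1))%N.
  by rewrite XS size_cat -[X in (X < _)%N]addn0 ltn_add2l; have [] := stepP (size (X n), n).
have geX n : (n <= size (X n))%N.
  by elim: n => [//|n IH]; exact: leq_ltn_trans (ltX n).
have Xle n n' : (n <= n')%N -> prefix (X n) (X n').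
  elim: n' => [|n' IH]; first by rewrite leqn0 => /eqP ->; exact: prefix_refl.
  rewrite leq_eqVlt => /orP[/eqP ->|]; first exact: prefix_refl.
  by rewrite ltnS => /IH h; rewrite XS; apply: prefix_trans h _; exact: prefix_prefix.
(* [X i.+1] has length at least [i.+1], so position [i] is defined there. *)
pose x i := nth false (X i.+1) i.
have xE n i : (i < size (X n))%N -> x i = nth false (X n) i.
  move=> iX; rewrite /x; case/orP: (leq_total i.+1 n) => /Xle /prefixP[w ->].
    by rewrite nth_cat geX.
  by rewrite nth_cat iX.
exists (fun n => size (X n)), x; split => [|//|A]; first by rewrite X0.
move=> n Ax m mn.
have := (stepP (size (X n), n)).2 (mkseq A (size (X n))).
rewrite size_mkseq => /(_ erefl _ mn)[v Wv].
have -> : mkseq A (size (X n)) ++ step (size (X n), n) = mkseq A (size (X n.+1)).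
  apply: (@eq_from_nth _ false); rewrite size_cat !size_mkseq; first by rewrite XS size_cat.
  move=> i iX; have iX' : (i < size (X n.+1))%N by rewrite XS size_cat.
  rewrite nth_cat size_mkseq [RHS]nth_mkseq//; case: ltnP => iXn; first by rewrite nth_mkseq.
  by rewrite Ax ?iXn ?iX'// (xE n.+1)// XS nth_cat ltnNge iXn.
move=> /extends_prefix/(_ (extends_mkseq _ _)) vA.
by exists (size v); rewrite vA.
Qed.

Lemma injective_unbounded (f : nat -> nat) M : injective f -> exists j, (M <= f j)%N.
Proof.
move=> f_inj; apply: contrapT => fM.
have : (size (map f (iota 0 M.+1)) <= size (iota 0 M))%N.
  apply: uniq_leq_size; first by rewrite map_inj_uniq// iota_uniq.
  move=> _ /mapP[j _ ->]; rewrite mem_iota/= add0n ltnNge.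
  by apply/negP => Mf; apply: fM; exists j.
by rewrite size_map !size_iota ltnn.
Qed.

Lemma sum_mod_le d q c : (\sum_(i < q * d) (i %% d == c) <= q)%N.
Proof.
elim: q => [|q IH]; first by rewrite big_ord0.
rewrite mulSn big_split_ord /= -addn1 addnC; apply: leq_add.
  by under eq_bigr => i _ do rewrite modnDl.
under eq_bigr => i _ do rewrite modn_small//.
case: (ltnP c d) => cd.
  rewrite (bigD1 (Ordinal cd))//= eqxx big1 ?addn0// => i.
  by rewrite -val_eqE /= => /negbTE ->.
rewrite big1// => i _; apply/eqP; rewrite eqb0; apply/eqP => ic.
by have := ltn_ord i; rewrite ic ltnNge cd.
Qed.

Lemma sum_pow2_le n : (\sum_(j < n) 2 ^ (n - j.+1) <= 2 ^ n)%N.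
Proof.
elim: n => [|n IH]; first by rewrite big_ord0.
rewrite big_ord_recl /= subn1 /= expnS mul2n -addnn leq_add2l.
exact: leq_trans IH.
Qed.

(** * Block averages and their limit along an ultrafilter *)

Definition avg (R : realType) (a : nat -> R) (m : nat) : R :=
  (\sum_(i < 2 ^ m) a (2 ^ m + i)%N) / (2 ^ m)%:R.

Section Functional.
Variables (R : realType) (K : topologicalType) (e : nat -> K).
Hypothesis He : is_beta_omega R e.
Variable x : K.
Hypothesis xe : ~ range e x.
Implicit Types (A B : nat -> bool) (a b : nat -> R) (p : nat -> K).

Local Notation ev := (@ev R K e).

(** Evaluating the extension at [x] takes the limit of the block averages along the ultrafilter
    [x]. *)
Definition state (f : K -> R) : R := ext e (avg (f \o e)) x.

Lemma pow2_gt0 m : (0 : R) < (2 ^ m)%:R.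
Proof. by rewrite ltr0n expn_gt0. Qed.

(** Block [m] starts at 2^m > m. *)
Lemma le_avg a b m : (forall n, (m <= n)%N -> a n <= b n) -> avg a m <= avg b m.
Proof.
move=> ab; rewrite ler_pM2r ?invr_gt0 ?pow2_gt0//; apply: ler_sum => i _.
by apply: ab; apply: leq_trans (leq_addr _ _); apply: ltnW; exact: ltn_expl.
Qed.

Lemma avg_lin (c : R) a b m :
  avg (fun n => c * a n + b n) m = c * avg a m + avg b m.
Proof. by rewrite /avg big_split/= -mulr_sumr mulrDl mulrA. Qed.

Lemma avg_cst (c : R) m : avg (fun=> c) m = c.
Proof.
rewrite /avg big_const_ord iter_addr_0 -[c *+ _]mulr_natr mulfK// gt_eqF// pow2_gt0.
Qed.

Lemma avg_bound a (M : R) m : (forall n, `|a n| <= M) -> `|avg a m| <= M.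
Proof.
move=> aM; rewrite ler_norml; apply/andP; split.
  by rewrite -(avg_cst (- M) m); apply: le_avg => n _; have := aM n; rewrite ler_norml => /andP[].
by rewrite -[leRHS](avg_cst M m); apply: le_avg => n _; have := aM n; rewrite ler_norml => /andP[].
Qed.

Lemma bounded_avg a : bounded_seq a -> bounded_seq (avg a).
Proof. by move=> [M aM]; exists M => m; exact: avg_bound. Qed.

Lemma bounded_lin (c : R) a b : bounded_seq a -> bounded_seq b ->
  bounded_seq (fun n => c * a n + b n).
Proof.
move=> [M aM] [M' bM']; exists (`|c| * M + M') => n.
apply: le_trans (ler_normD _ _) _; rewrite normrM lerD//.
by rewrite ler_wpM2l.
Qed.

Lemma ext_lin (c : R) a b y : bounded_seq a -> bounded_seq b ->
  ext e (fun n => c * a n + b n) y = c * ext e a y + ext e b y.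
Proof.
move=> ba bb; have bab := bounded_lin c ba bb.
apply: (eq_on_omega He (G := fun y => c * ext e a y + ext e b y)).
- exact: ext_cont.
- move=> z; apply: cvgD; last exact: ext_cont.
  by apply: cvgMr; exact: ext_cont.
- by move=> n; rewrite !extE.
Qed.

Lemma CK_bounded (f : K -> R) : CK f -> bounded_seq (f \o e).
Proof.
move=> cf; case: He => cK _.
have : compact (f @` setT) by apply: continuous_compact => //; exact: continuous_subspaceT.
move=> /compact_bounded [M [_ MP]]; exists (M + 1) => n /=.
by apply: (MP (M + 1)); rewrite ?ltrDl//; exists (e n).
Qed.

Lemma ext_avg_le (c : R) a b : bounded_seq a -> bounded_seq b ->
  (forall n, a n <= c + b n) -> ext e (avg a) x <= c + ext e (avg b) x.
Proof.
move=> ba bb ab.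
apply: (le_on_omega He (G := fun y => c + ext e (avg b) y)).
- by apply: ext_cont => //; exact: bounded_avg.
- by move=> y; apply: cvgD; [exact: cvg_cst|apply: ext_cont => //; exact: bounded_avg].
- move=> n; rewrite !extE//; try exact: bounded_avg.
  rewrite -[X in X + _](avg_cst c n) -[X in X + _]mul1r -avg_lin.
  by apply: le_avg => m _; rewrite mul1r.
Qed.

(** Averaging preserves bounds of the form a <= c + b, so the functional is 1-Lipschitz for the sup
    norm. *)
Lemma state_cont_lin : cont_lin_functional state.
Proof.
split=> [c f g cf cg|].
  rewrite /state -ext_lin; try (by apply: bounded_avg; exact: CK_bounded).
  congr (ext e _ x).
  by apply/funext => m; rewrite -avg_lin.
apply/subspace_continuousP => f cf; apply/cvgrPdist_le => eps eps0.
rewrite near_withinE; apply/uniform_nbhs.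
exists [set q : R * R | ball q.1 eps q.2]; split; first exact: (entourage_ball R (PosNum eps0)).
move=> g fg cg; have fge n : `|f (e n) - g (e n)| <= eps by apply/ltW/fg.
have [bf bg] := (CK_bounded cf, CK_bounded cg).
rewrite ler_distl lerBlDl [_ + eps]addrC; apply/andP; split; apply: ext_avg_le => // n /=.
- by have := fge n; rewrite ler_distl => /andP[]; lra.
- by have := fge n; rewrite ler_distl => /andP[]; lra.
Qed.

(** A finitely additive probability on the subsets of omega. *)
Definition mu A : R := ext e (avg (ind R A)) x.

Lemma state_chi A : state (chi R e A) = mu A.
Proof.
rewrite /state /mu; congr (ext e (avg _) x).
by apply/funext => n /=; rewrite chiE.
Qed.

(** The blocks from the [N]-th on lie beyond [N], and [x], being outside omega, ignores the earlier
    blocks. *)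
Lemma mu_leU N A B C : (forall n, (N <= n)%N -> A n -> B n || C n) -> mu A <= mu B + mu C.
Proof.
move=> ABC; rewrite /mu -[ext e (avg (ind R B)) x]mul1r.
rewrite -ext_lin; try (by apply: bounded_avg; exact: bounded_ind).
apply: (le_on_tail He (N := N)) => //.
- by apply: ext_cont => //; apply: bounded_avg; exact: bounded_ind.
- by apply: ext_cont => //; apply: bounded_lin; apply: bounded_avg; exact: bounded_ind.
move=> n Nn; rewrite !extE//; last 2 first.
- by apply: bounded_lin; apply: bounded_avg; exact: bounded_ind.
- by apply: bounded_avg; exact: bounded_ind.
rewrite -avg_lin; apply: le_avg => m nm; rewrite /ind.
by have := ABC m (leq_trans Nn nm); case: (A m) (B m) (C m) => -[] [] //= h; try lra; have := h isT.
Qed.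

Lemma mu_cst (b : bool) : mu (fun=> b) = b%:R.
Proof.
rewrite /mu (_ : avg _ = fun=> b%:R); last by apply/funext => m; exact: avg_cst.
have bb : bounded_seq (fun=> b%:R : R) by exists `|b%:R : R|.
apply: (eq_on_omega He (G := fun=> b%:R)); first exact: ext_cont.
- by move=> y; exact: cvg_cst.
- by move=> n; rewrite extE.
Qed.

Lemma mu_le N A B : (forall n, (N <= n)%N -> A n -> B n) -> mu A <= mu B.
Proof.
move=> AB; rewrite -[mu B]addr0 -[0](mu_cst false); apply: (mu_leU (N := N)) => n Nn An.
by rewrite AB.
Qed.

Lemma mu_disjoint A B (C : nat -> bool) : (forall n, B n -> C n -> False) ->
  (forall n, B n || C n -> A n) -> mu B + mu C <= mu A.
Proof.
move=> BC BCA; rewrite /mu -[ext e (avg (ind R B)) x]mul1r.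
rewrite -ext_lin; try (by apply: bounded_avg; exact: bounded_ind).
apply: (le_on_omega He) => //.
- by apply: ext_cont => //; apply: bounded_lin; apply: bounded_avg; exact: bounded_ind.
- by apply: ext_cont => //; apply: bounded_avg; exact: bounded_ind.
move=> n; rewrite !extE//; last 2 first.
- by apply: bounded_avg; exact: bounded_ind.
- by apply: bounded_lin; apply: bounded_avg; exact: bounded_ind.
rewrite -avg_lin; apply: le_avg => m _; rewrite /ind.
have := BC m; have := BCA m.
case: (A m) (B m) (C m) => -[] [] //= h1 h2; try lra; first [by have := h1 isT|by case: h2].
Qed.

Lemma mu_le1 A : mu A <= 1.
Proof.
apply: (le_on_omega He (G := fun=> 1)).
- by apply: ext_cont => //; apply: bounded_avg; exact: bounded_ind.
- by move=> y; exact: cvg_cst.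
move=> n; rewrite extE//; last by apply: bounded_avg; exact: bounded_ind.
rewrite -[leRHS](avg_cst 1 n); apply: le_avg => m _.
by rewrite /ind; case: (A m).
Qed.

End Functional.

(* A set of codes of nodes of the binary tree; a branch is almost contained in
   the cone of each of its nodes. *)
Definition cone (s : seq bool) (n : nat) : bool :=
  if @unpickle (seq bool) n is Some s' then prefix s s' else false.

Lemma cone_rcons s b n : cone (rcons s b) n -> cone s n.
Proof.
rewrite /cone; case: unpickle => [s'|//]; apply: prefix_trans.
by rewrite -cats1 prefix_prefix.
Qed.

Lemma cone_disjoint s n : cone (rcons s false) n -> cone (rcons s true) n -> False.
Proof.
rewrite /cone; case: unpickle => [s'|//].
rewrite -!cats1 => /prefixP[w ->] /prefixP[w'].
by rewrite -!catA => /eqP; rewrite eqseq_cat// eqxx.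
Qed.

(** * Thin and large sets avoiding countably many ultrafilters *)

Section Thin.
Variables (R : realType) (K : topologicalType) (e : nat -> K).
Hypothesis He : is_beta_omega R e.
Variable x : K.
Hypothesis xe : ~ range e x.
Implicit Types (A B : nat -> bool) (p : nat -> K).

Local Notation ev := (@ev R K e).
Local Notation mu := (mu R e x).
Local Notation vanish := (@vanish R K e).

(** Descend in the binary tree, measuring cones through [blk]: each of the first two steps takes a
    child of at most half the measure, and then the j-th step takes a child not in [p j], since
    disjoint cones cannot both belong to an ultrafilter. The nodes of the resulting branch form [N],
    which is almost contained in each of their cones. *)
Lemma thin_branch p (blk : nat -> nat) :
  (forall M, exists N, forall i, (N <= i)%N -> (M <= blk i)%N) ->
  exists N : nat -> bool, [/\ forall M, exists2 n, (M <= n)%N & N n,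
    vanish p (N \o blk) & mu (N \o blk) <= 1 / 4].
Proof.
move=> blkoo.
have halve s : exists b, mu (cone (rcons s b) \o blk) <= mu (cone s \o blk) / 2.
  have := @mu_disjoint _ _ _ He x (cone s \o blk) (cone (rcons s false) \o blk)
    (cone (rcons s true) \o blk) _ _.
  move=> h; have {}h := h (fun n => @cone_disjoint s (blk n)).
  have {}h : mu (cone (rcons s false) \o blk) + mu (cone (rcons s true) \o blk)
      <= mu (cone s \o blk).
    by apply: h => n /= /orP[]; exact: cone_rcons.
  case: (lerP (mu (cone (rcons s false) \o blk)) (mu (cone s \o blk) / 2)) => h0.
    by exists false.
  by exists true; lra.
have [b0 h0] := halve [::]; have [b1 h1] := halve (rcons [::] b0).
have hle1 := mu_le1 He x (cone [::] \o blk).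
have kill (q : nat * seq bool) : exists b, ev (p q.1) (cone (rcons q.2 b) \o blk) = false.
  case h : (ev (p q.1) (cone (rcons q.2 false) \o blk)); last by exists false.
  exists true; apply/negP => h'.
  have := ev_and He (cone (rcons q.2 false) \o blk) (cone (rcons q.2 true) \o blk) (p q.1).
  rewrite h h' (_ : (fun n => _) = fun=> false) ?ev_false//.
  by apply/funext => n; apply/negP => /andP[]; exact: cone_disjoint.
have [b bP] := choice kill.
have [S [S0 SS]] : exists S : nat -> seq bool,
    S 0%N = [:: b0; b1] /\ forall j, S j.+1 = rcons (S j) (b (j, S j)).
  by exists (fix S j := if j is j'.+1 then rcons (S j') (b (j', S j')) else [:: b0; b1]).
have sizeS j : size (S j) = j.+2.
  by elim: j => [|j IH]; rewrite ?S0// SS size_rcons IH.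
have pS i j : (i <= j)%N -> prefix (S i) (S j).
  elim: j => [|j IH]; first by rewrite leqn0 => /eqP ->; exact: prefix_refl.
  rewrite leq_eqVlt => /orP[/eqP ->|]; first exact: prefix_refl.
  by rewrite ltnS => /IH h; rewrite SS -cats1; apply: prefix_trans h _; exact: prefix_prefix.
pose N n : bool := `[< exists j, n = pickle (S j) >].
have Ncone j : exists M, forall n, (M <= n)%N -> N n -> cone (S j) n.
  (* This bound exceeds the codes of all nodes before the j-th. *)
  exists (\sum_(i < j) (pickle (S i)).+1)%N => n jn /asboolP[i nE].
  rewrite /cone nE pickleK; apply: pS; rewrite leqNgt; apply/negP => ij.
  move: jn; rewrite nE (bigD1 (Ordinal ij))//=; apply/negP; rewrite -ltnNge.
  by rewrite ltnS leq_addr.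
have Nblk j : exists M, forall i, (M <= i)%N -> (N \o blk) i -> (cone (S j) \o blk) i.
  have [M MP] := Ncone j; have [M' M'P] := blkoo M.
  by exists M' => i /M'P /MP.
exists N; split.
- move=> M; have [|j Mj] := @injective_unbounded (fun j => pickle (S j)) M.
    move=> i j /(pcan_inj pickleK) /(congr1 size); rewrite !sizeS; by case.
  by exists (pickle (S j)) => //; apply/asboolP; exists j.
- move=> j pj; apply/negP => Npj; have [M MP] := Nblk j.+1.
  have := ev_sub_tail He MP pj Npj.
  by rewrite SS (bP (j, S j)).
- have [M MP] := Nblk 0%N; apply: le_trans (mu_le He xe MP) _.
  by rewrite S0; rewrite /= in h0 h1 *; lra.
Qed.

Lemma ev_has (y : K) (P : nat -> nat -> bool) (l : seq nat) :
  ev y (fun n => has (P^~ n) l) -> exists2 c, c \in l & ev y (P c).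
Proof.
elim: l => [|c l IH] /=; first by rewrite ev_false.
rewrite ev_or// => /orP[yc|/IH[c' c'l yc']]; first by exists c; rewrite ?inE ?eqxx.
by exists c' => //; rewrite inE c'l orbT.
Qed.

(** In block m only classes with j + 3 <= m are removed, and class j costs at most 2^(m-j-3)
    numbers; the total is at most 2^(m-2), a quarter of the block. *)
Lemma large_vanishing_set p : exists B, vanish p B /\ 3 / 4 <= mu B.
Proof.
have resid j : exists c, ev (p j) (fun n => (n %% 2 ^ (j + 3))%N == c).
  have [|c _ cP] := @ev_has (p j) (fun c n => (n %% 2 ^ (j + 3))%N == c) (iota 0 (2 ^ (j + 3))%N).
    have := ev_neg He (fun=> false) (p j); rewrite ev_false// => h.
    apply: ev_sub h => // n _; apply/hasP; exists (n %% 2 ^ (j + 3))%N => //=.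
    by rewrite mem_iota/= add0n ltn_mod expn_gt0.
  by exists c.
have [c cP] := choice resid.
(* Sparing the numbers below 2^(j+3) does not matter to a non-principal [p j]; it also forces j < n,
   so the bounded search misses no class. *)
pose bad n := has (fun j => (2 ^ (j + 3) <= n)%N && ((n %% 2 ^ (j + 3))%N == c j)) (iota 0 n).
exists (fun n => ~~ bad n); split.
  move=> j pj; rewrite ev_neg//; apply/negbF.
  apply: (ev_sub_tail He (N := (2 ^ (j + 3))%N)) (cP j) => // n jn nc.
  apply/hasP; exists j; last by rewrite jn.
  rewrite mem_iota/= add0n; apply: leq_trans jn.
  by rewrite addn3; apply: ltn_trans (ltn_expl _ _) => //; rewrite ltnS leqW.
suff mubad : mu bad <= 1 / 4.
  have : mu (fun=> true) <= mu (fun n => ~~ bad n) + mu bad.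
    by apply: (mu_leU He xe (N := 0)) => n _ _; case: (bad n).
  by rewrite mu_cst//=; lra.
have bbad := bounded_avg (bounded_ind R bad).
apply: (le_on_omega He (G := fun=> 1 / 4)); first exact: ext_cont.
  by move=> y; exact: cvg_cst.
move=> m; rewrite extE// /avg /ind -natr_sum ler_pdivrMr ?pow2_gt0//.
suff : (4 * \sum_(i < 2 ^ m) bad (2 ^ m + i)%N <= 2 ^ m)%N.
  by rewrite -(ler_nat R) natrM; lra.
have badle : (\sum_(i < 2 ^ m) bad (2 ^ m + i)%N <= \sum_(j < m - 2) 2 ^ (m - 2 - j.+1))%N.
  apply: (@leq_trans (\sum_(i < 2 ^ m) \sum_(j < m - 2)
      ((2 ^ m + i) %% 2 ^ (j + 3) == c j)%N)%N).
    apply: leq_sum => i _; case badi : (bad _) => //.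
    have /hasP[j _ /andP[jm jc]] := badi.
    have jm2 : (j < m - 2)%N.
      have : (2 ^ (j + 3) < 2 ^ m.+1)%N.
        by apply: leq_ltn_trans jm _; rewrite expnS mul2n -addnn ltn_add2l.
      by rewrite ltn_exp2l//; lia.
    by rewrite (bigD1 (Ordinal jm2))//= jc.
  rewrite exchange_big /=; apply: leq_sum => j _.
  have jm := ltn_ord j.
  have mE : (2 ^ m = 2 ^ (m - 2 - j.+1) * 2 ^ (j + 3))%N.
    by rewrite -expnD; congr (2 ^ _)%N; lia.
  rewrite mE; apply: leq_trans (sum_mod_le _ _ (c j)).
  by apply: leq_sum => i _; rewrite modnMDl.
(* For m < 2 the truncated [m - 2] is 0, and nothing is removed from the block. *)
case: (ltnP m 2) => m2.
  have m20 : (m - 2 = 0)%N by lia.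
  by move: badle; rewrite m20 big_ord0 leqn0 => /eqP ->.
apply: (@leq_trans (4 * 2 ^ (m - 2))%N).
  by rewrite leq_mul2l /=; apply: leq_trans badle (sum_pow2_le _).
by rewrite -(expnD 2 2) subnKC.
Qed.

End Thin.

(** * Points outside omega, weak continuity, and generic modification *)

Section LimitPoint.
Variables (R : realType) (K : topologicalType) (e : nat -> K).
Hypothesis He : is_beta_omega R e.

(** A cluster point of the sequence [e] is no [e n], because the isolating neighbourhood of [e n]
    misses all later terms. *)
Lemma exists_limit_point : exists x, ~ range e x.
Proof.
have [cK [_ e_inj iso _ _]] := He.
have [x [_ cx]] := cK (e @ \oo) _ filterT; exists x => -[n _ xn].
have [U [oU Un]] := iso n.
have Ux : U x by rewrite -xn; suff [] : (U `&` range e) (e n) by []; rewrite Un.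
have [y [[m /= nm <-] Uy]] := cx (e @` [set m | (n < m)%N]) U
  (filterS (fun m nm => ex_intro2 _ _ m nm erefl) (nbhs_infty_gt n)) (open_nbhs_nbhs (conj oU Ux)).
have : (U `&` range e) (e m) by split => //; exists m.
by rewrite Un => /= /e_inj mn; move: nm; rewrite mn ltnn.
Qed.

Lemma dual_continuous (l : (K -> R) -> R) : cont_lin_functional l ->
  continuous (l : Cw_space R K -> R).
Proof.
move=> hl.
pose i : dual R K := exist _ l hl.
have c1 : continuous ((fun h => h i) : {ptws dual R K -> R} -> R).
  move=> h; have /cvg_sup/(_ i) : nbhs (h : {ptws dual R K -> R}) -->
      (h : {ptws dual R K -> R}) by [].
  move=> hi; apply: (cvg_trans (cvg_app _ hi)).
  exact: (@initial_continuous _ _ (fun h : dual R K -> R => h i)).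
have c2 : continuous (@dual_eval R K : Cw_space R K -> {ptws dual R K -> R}).
  exact: initial_continuous.
move=> f; exact: (@continuous_comp _ _ _ _ _ f (c2 f) (c1 _)).
Qed.

(** [M] is the union of the fusion blocks with index in a thin set. Beyond [t], [Y] copies the
    fusion sequence on [M], which makes it generic, and copies [Z] elsewhere. *)
Lemma generic_modification x p t (W : nat -> set (seq bool)) :
  ~ range e x -> (forall m, dense_seq (W m)) ->
  exists2 M : nat -> bool, mu R e x M <= 1 / 4 &
    forall Z, vanish R e p Z -> exists Y, [/\ extends Y t, vanish R e p Y,
      forall m, hits Y (W m) &
      exists L, forall i, (L <= i)%N -> (Y i -> Z i || M i) /\ (Z i -> Y i || M i)].
Proof.
move=> xe dW; have [k [y [k0 kS ky]]] := fusion t dW.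
have kmono : {homo k : i j / (i <= j)%N}.
  by apply: homo_leq => [i|j i l|n]; [exact: leqnn|exact: leq_trans|exact: ltnW].
have ge_k n : (n <= k n)%N.
  by elim: n => [//|n IH]; exact: leq_ltn_trans (kS n).
have exblk i : exists n, (i < k n.+1)%N by exists i; exact: ge_k.
(* The index of the block containing [i]; positions below [k 0], where [t] lives, get index 0. *)
pose blk i := ex_minn (exblk i).
have blk_ge n i : (k n <= i)%N -> (n <= blk i)%N.
  rewrite /blk; case: ex_minnP => n' in' _ kni; rewrite leqNgt; apply/negP => /kmono kn'n.
  by move: in'; rewrite ltnNge (leq_trans kn'n kni).
have blkE n i : (k n <= i < k n.+1)%N -> blk i = n.
  move=> /andP[kn ink]; apply/eqP; rewrite eqn_leq (blk_ge _ _ kn) andbT /blk.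
  by case: ex_minnP => n' _; apply.
have [N [Noo pN muN]] := thin_branch He xe p (fun M => ex_intro _ (k M) (blk_ge M)).
exists (N \o blk) => // Z pZ.
pose Y i := if (i < size t)%N then nth false t i else if N (blk i) then y i else Z i.
have YM i : (size t <= i)%N -> (Y i -> Z i || N (blk i)) /\ (Z i -> Y i || N (blk i)).
  by rewrite leqNgt /Y => /negbTE ->; case: (N (blk i)); rewrite ?orbT ?orbF.
exists Y; split; last by exists (size t).
- by apply/extendsP => i it; rewrite /Y it.
- move=> n pn; apply/negP => Yn.
  have := ev_sub_tail He (fun i ti => (YM i ti).1) pn Yn.
  by rewrite ev_or// pZ// (pN n pn).
- move=> m; have [n mn Nn] := Noo m.
  apply: (ky Y n) mn => i /andP[kn ink].
  rewrite /Y ltnNge -k0 (leq_trans (kmono _ _ (leq0n n)) kn) /=.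
  by rewrite (blkE n) ?kn// Nn.
Qed.

End LimitPoint.

Theorem theorem3p4 (R : realType) (K : topologicalType) (e : nat -> K) :
  is_beta_omega R e ->
  @baire R (Cp_space R K) (@CK R K) <> @baire R (Cw_space R K) (@CK R K).
Proof.
move=> He; have [x xe] := exists_limit_point He; move=> eqB.
have cl := state_cont_lin He x.
pose E0 : set (K -> R) := @CK R K `&` state e x @^-1` [set r | 1 / 4 < r].
have E0w : @baire R (Cw_space R K) (@CK R K) E0.
  apply: sub_gen_smallest; exists (state e x), [set r | 1 / 4 < r]; split => //.
  by apply: continuous_subspaceT; exact: dual_continuous.
have [p pE0] : decided e E0 by apply: (baire_decided He); rewrite eqB.
(* A single basic open set on which [E0] is decided suffices. *)
have [t _ tE0] := pE0 [::].
case: tE0 => [[W [dW WE]]|[W [dW WE]]];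
  have [M muM MP] := generic_modification He p t xe dW.
(* If [E0] is generic, modifying the empty set gives a [Y] in [E0] of measure at most 1/4. *)
- have p0 : vanish R e p (fun=> false) by move=> n _; rewrite ev_false.
  have [Y [tY pY WY [L LP]]] := MP _ p0.
  have [_ /=] := WE Y tY pY WY; rewrite state_chi//.
  have /(mu_le He xe) : forall i, (L <= i)%N -> Y i -> M i by move=> i /LP[].
  by lra.
(* If the complement is generic, modifying [Z] leaves measure at least 3/4 - 1/4, which exceeds
   1/4. *)
- have [Z [pZ muZ]] := large_vanishing_set He xe p.
  have [Y [tY pY WY [L LP]]] := MP _ pZ.
  apply: (WE Y tY pY WY); split; first exact: chi_cont.
  rewrite /= state_chi//.
  have /(mu_leU He xe) : forall i, (L <= i)%N -> Z i -> Y i || M i by move=> i /LP[].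
  by lra.
Qed.
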